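(* Let $\mathcal L$ be a logic over a countable language. If the Leibniz operator $\Omega\colon\mathrm{Th}\mathcal L\to\mathrm{Con}\,\mathbf{Fm}$ is injective (resp. almost injective), then for every algebra $\mathbf A$ the Leibniz operator $\Omega^{\mathbf A}$ restricted to $\mathcal{F}i_{\mathcal L}\mathbf A$ is injective (resp. almost injective).
   Context: Fix an algebraic type and a countably infinite set of variables; $Fm$ is the set of formulas, $\mathbf{Fm}$ the formula algebra. A logic $\mathcal L$ is a structural closure operator on $\mathcal P(Fm)$; $\Gamma\vdash_{\mathcal L}\varphi$ means $\varphi$ is in the closure of $\Gamma$. A deductive filter of $\mathcal L$ over an algebra $\mathbf A$ is $F\subseteq A$ such that $\Gamma\vdash_{\mathcal L}\varphi$ and $h[\Gamma]\subseteq F$ for a homomorphism $h\colon\mathbf{Fm}\to\mathbf A$ imply $h(\varphi)\in F$; $\mathcal{F}i_{\mathcal L}\mathbf A$ is the set of these, and $\mathrm{Th}\mathcal L=\mathcal{F}i_{\mathcal L}\mathbf{Fm}$. The Leibniz congruence $\Omega^{\mathbf A}F$ is the largest congruence of $\mathbf A$ compatible with $F$ ($\langle a,b\rangle\in\theta$, $a\in F$ imply $b\in F$); $\Omega=\Omega^{\mathbf{Fm}}$. ''Almost injective'' means that the restriction to the non-empty filters is injective. *)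

(* Defs.v *)
From mathcomp Require Import all_boot all_classical.
From Stdlib Require Import Relation_Operators.

Set Implicit Arguments.
Unset Strict Implicit.
Unset Printing Implicit Defensive.

Local Open Scope classical_set_scope.

Record signature := Signature {
  symbol : Type;
  arity : symbol -> nat }.

(* The carrier may be empty (when there are no constant symbols). *)
Record algebra (S : signature) := Algebra {
  carrier :> Type;
  interp : forall o : symbol S, ('I_(arity o) -> carrier) -> carrier }.

Definition is_hom (S : signature) (A B : algebra S) (h : A -> B) : Prop :=
  forall (o : symbol S) (x : 'I_(arity o) -> A),
    h (interp x) = interp (fun i => h (x i)).

Inductive formula (S : signature) (V : Type) : Type :=
| Var of V
| App (o : symbol S) of ('I_(arity o) -> formula S V).

Definition Fm (S : signature) (V : Type) : algebra S :=
  Algebra (@App S V).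

Record congruence (S : signature) (A : algebra S) := Congruence {
  congr_rel :> A -> A -> Prop;
  congr_refl : forall a, congr_rel a a;
  congr_sym : forall a b, congr_rel a b -> congr_rel b a;
  congr_trans : forall a b c, congr_rel a b -> congr_rel b c -> congr_rel a c;
  congr_interp : forall (o : symbol S) (x y : 'I_(arity o) -> A),
    (forall i, congr_rel (x i) (y i)) -> congr_rel (interp x) (interp y) }.

Lemma congruence_ext (S : signature) (A : algebra S) (t e : congruence A) :
  (forall a b, t a b <-> e a b) -> t = e.
Proof.
case: t e => [r r1 r2 r3 r4] [q q1 q2 q3 q4] /= rq.
have E : r = q by apply: funext => a; apply: funext => b; apply/propext.
by subst q; congr Congruence; apply: Prop_irrelevance.
Qed.

Definition compatible (S : signature) (A : algebra S)
    (theta : congruence A) (F : set A) : Prop :=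
  forall a b, theta a b -> F a -> F b.

Definition is_largest_compatible (S : signature) (A : algebra S)
    (F : set A) (theta : congruence A) : Prop :=
  compatible theta F /\
  forall eta : congruence A, compatible eta F ->
    forall a b, eta a b -> theta a b.

(* The largest compatible congruence is the transitive closure of the union of
   all compatible ones; arities being finite, that closure is again a
   congruence. *)
Lemma largest_compatible_exists (S : signature) (A : algebra S) (F : set A) :
  exists theta : congruence A, is_largest_compatible F theta.
Proof.
pose U a b := exists2 eta : congruence A, compatible eta F & eta a b.
pose R := clos_trans A U.
have Rrefl a : R a a.
  apply: t_step; unshelve eexists (@Congruence S A (@eq A) _ _ _ _) => //=.
  - by move=> ? ? ? -> ->.
  - by move=> o x y xy; congr interp; apply: funext.
  - by move=> ? ? /= ->.
have Rsym a b : R a b -> R b a.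
  elim=> [c d [eta ce cd]|c d e _ IH1 _ IH2].
    by apply: t_step; exists eta => //; apply: congr_sym.
  exact: (t_trans _ _ _ _ _ IH2 IH1).
have Rtrans a b c : R a b -> R b c -> R a c by exact: t_trans.
have R1 (o : symbol S) (z : 'I_(arity o) -> A) k a b : R a b ->
    R (interp (fun i => if i == k then a else z i))
      (interp (fun i => if i == k then b else z i)).
  elim=> [c d [eta ce cd]|c d e _ IH1 _ IH2]; last exact: (Rtrans _ _ _ IH1 IH2).
  apply: t_step; exists eta => //; apply: congr_interp => i.
  by case: ifP => // _; apply: congr_refl.
have Rint (o : symbol S) (x y : 'I_(arity o) -> A) :
    (forall i, R (x i) (y i)) -> R (interp x) (interp y).
  move=> xy.
  pose z k (i : 'I_(arity o)) := if (i < k)%N then y i else x i.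
  have Rz k : (k <= arity o)%N -> R (interp x) (interp (z k)).
    elim: k => [_|k IH lk].
      by have -> : z 0%N = x by apply: funext.
    apply: (Rtrans _ _ _ (IH (ltnW lk))).
    have := R1 o (z k) (Ordinal lk) _ _ (xy (Ordinal lk)).
    set f := (f in interp f); set g := (g in R _ (interp g)).
    have -> : f = z k.
      apply: funext => i; rewrite /f; case: eqP => // ->.
      by rewrite /z /= ltnn.
    have -> // : g = z k.+1.
    apply: funext => i; rewrite /g; case: eqP => [->|ne].
      by rewrite /z /= ltnSn.
    rewrite /z [(i < k.+1)%N]ltnS [(i <= k)%N]leq_eqVlt; case: eqP => //= ik.
    by case: ne; apply: val_inj.
  have := Rz _ (leqnn _).
  suff -> : z (arity o) = y by [].
  by apply: funext => i; rewrite /z ltn_ord.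
exists (@Congruence S A R Rrefl Rsym Rtrans Rint); split.
  move=> a b /=; elim=> [c d [eta ce cd]|c d e _ IH1 _ IH2].
    exact: ce cd.
  by move=> /IH1 /IH2.
by move=> eta ce a b ab; apply: t_step; exists eta.
Qed.

Definition leibniz (S : signature) (A : algebra S) (F : set A) : congruence A :=
  sval (cid (largest_compatible_exists F)).

Record logic (S : signature) (V : Type) := Logic {
  entails :> set (Fm S V) -> set (Fm S V);
  logic_extensive : forall G, G `<=` entails G;
  logic_monotone : forall G D, G `<=` D -> entails G `<=` entails D;
  logic_idempotent : forall G, entails (entails G) = entails G;
  logic_structural : forall (s : Fm S V -> Fm S V), is_hom s ->
    forall G, s @` entails G `<=` entails (s @` G) }.

Definition deductive_filter (S : signature) (V : Type) (L : logic S V)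
    (A : algebra S) : set (set A) :=
  [set F | forall (G : set (Fm S V)) (phi : Fm S V), L G phi ->
    forall h : Fm S V -> A, is_hom h -> h @` G `<=` F -> F (h phi)].
Arguments deductive_filter {S V} L A.

Definition theory (S : signature) (V : Type) (L : logic S V) :
    set (set (Fm S V)) :=
  deductive_filter L (Fm S V).

Definition almost_inj (S : signature) (A : algebra S) (X : set (set A))
    (f : set A -> congruence A) : Prop :=
  set_inj [set F | X F /\ F !=set0] f.

(* Main.v *)
(* As in the downward Löwenheim-Skolem theorem, a point where two filters [F]
   and [G] of [A] differ lies in a countable subalgebra [B] of [A] such that two
   elements of [B] separated by a unary translation of [A] relative to [F] (or
   [G]) are already separated by a translation with parameters in [B].  A
   homomorphism [k] from [Fm] onto [B] then pulls back [F] and [G] to theories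
   whose Leibniz congruences are the pullbacks along [k] of those of [F] and
   [G], so injectivity on theories applies. *)
Require Import Defs.
From mathcomp Require Import all_boot all_classical.

Local Open Scope classical_set_scope.
Local Open Scope card_scope.

(** * Leibniz congruences and separation by unary translations *)

Lemma leibnizP (S : signature) (A : algebra S) (F : set A) :
  is_largest_compatible F (leibniz F).
Proof. exact: svalP (cid (largest_compatible_exists F)). Qed.

Definition subst_at (n : nat) (T : Type) (z : 'I_n -> T) (k : 'I_n) (a : T) :
  'I_n -> T := fun i => if i == k then a else z i.

(** Arguments are replaced one at a time, from left to right: [z k] agrees with [y] before position
    [k] and with [x] from there on. Arities being finite, transitivity joins the steps. *)
Lemma interp_congr (S : signature) (A : algebra S) (R : A -> A -> Prop) :
  (forall a, R a a) -> (forall a b c, R a b -> R b c -> R a c) ->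
  (forall (o : symbol S) z k a b, R a b ->
     R (interp (subst_at (arity o) A z k a))
       (interp (subst_at (arity o) A z k b))) ->
  forall (o : symbol S) (x y : 'I_(arity o) -> A),
    (forall i, R (x i) (y i)) -> R (interp x) (interp y).
Proof.
move=> Rrefl Rtrans R1 o x y xy.
pose z k (i : 'I_(arity o)) := if (i < k)%N then y i else x i.
suff Rz k : (k <= arity o)%N -> R (interp x) (interp (z k)).
  have -> : y = z (arity o) by apply: funext => i; rewrite /z ltn_ord.
  exact: Rz.
elim: k => [_|k IH lk]; first by have -> : z 0%N = x by apply: funext.
apply: (Rtrans _ _ _ (IH (ltnW lk))).
have zk : z k = subst_at _ A (z k) (Ordinal lk) (x (Ordinal lk)).
  apply: funext => i; rewrite /subst_at; case: eqP => // ->.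
  by rewrite /z /= ltnn.
have zk1 : z k.+1 = subst_at _ A (z k) (Ordinal lk) (y (Ordinal lk)).
  apply: funext => i; rewrite /subst_at; case: eqP => [->|ne].
    by rewrite /z /= ltnSn.
  rewrite /z [(i < k.+1)%N]ltnS [(i <= k)%N]leq_eqVlt; case: eqP => //= ik.
  by case: ne; apply: val_inj.
by rewrite zk1 [X in R (interp X)]zk; apply: R1.
Qed.

(* [separated F C a b]: some unary translation with parameters in [C] sends
   exactly one of [a] and [b] into [F]. *)
Inductive separated (S : signature) (A : algebra S) (F C : set A) :
  A -> A -> Prop :=
| separated_base a b : ~ (F a <-> F b) -> separated S A F C a b
| separated_step (o : symbol S) (z : 'I_(arity o) -> A) k a b :
    (forall i, C (z i)) ->
    separated S A F C (interp (subst_at _ A z k a))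
                      (interp (subst_at _ A z k b)) ->
    separated S A F C a b.
Arguments separated {S A} F C.
Arguments separated_step {S A F C o} z k {a b}.

Section Separated.
Context {S : signature} {A : algebra S}.
Implicit Types (F C : set A) (a b c : A).

Lemma separated_sub F C D a b :
  C `<=` D -> separated F C a b -> separated F D a b.
Proof.
move=> CD; elim=> [c d cd|o z k c d Cz _ IH]; first exact: separated_base.
by apply: (separated_step z k) IH => i; apply/CD/Cz.
Qed.

Lemma separated_irrefl F C a : ~ separated F C a a.
Proof.
suff neq x y : separated F C x y -> x <> y by move/neq.
elim=> {x y} [x y xy e|o z k x y _ _ IH e]; first by apply: xy; rewrite e.
by apply: IH; rewrite e.
Qed.

Lemma separated_sym F C a b : separated F C a b -> separated F C b a.
Proof.
elim=> [c d cd|o z k c d Cz _ IH]; first by apply: separated_base; tauto.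
exact: (separated_step z k).
Qed.

(** The translation that separates [a] from [c] also sends [b] into [F] or not, and so separates [b]
    from one of the two. This is transitivity of inseparability, in contrapositive form. *)
Lemma separated_cotrans F C a b c :
  separated F C a c -> separated F C a b \/ separated F C b c.
Proof.
move=> s; elim: s b => {a c} [a c ac|o z k a c Cz _ IH] b.
  have [ab|ab] := EM (F a <-> F b); last by left; apply: separated_base.
  by right; apply: separated_base; tauto.
by have [?|?] := IH (interp (subst_at _ A z k b)); [left|right];
  apply: (separated_step z k).
Qed.

(** A compatible congruence is preserved by translations, so no translation separates related
    points. Conversely, inseparability is itself a congruence compatible with [F], hence lies below
    the largest one. *)
Lemma leibniz_separated F a b : leibniz F a b <-> ~ separated F setT a b.
Proof.
have [Fcomp Fmax] := leibnizP S A F; split.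
  move=> ab s; elim: s ab => {a b} [a b nab ab|o z k a b _ _ IH ab].
    by apply: nab; split; apply: Fcomp => //; apply: congr_sym.
  apply: IH; apply: congr_interp => i; rewrite /subst_at.
  by case: ifP => // _; apply: congr_refl.
have nsym a' b' : ~ separated F setT a' b' -> ~ separated F setT b' a'.
  by move=> n /separated_sym.
have ntrans a' b' c' : ~ separated F setT a' b' -> ~ separated F setT b' c' ->
    ~ separated F setT a' c'.
  by move=> ? ? /(separated_cotrans _ _ _ b')[].
have nstep (o : symbol S) z k a' b' : ~ separated F setT a' b' ->
    ~ separated F setT (interp (subst_at (arity o) A z k a'))
                       (interp (subst_at (arity o) A z k b')).
  by move=> n s; apply: n; apply: (separated_step z k).
have nrefl := separated_irrefl F setT.
pose theta := @Congruence S A (fun a b => ~ separated F setT a b)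
  nrefl nsym ntrans (interp_congr S A _ nrefl ntrans nstep).
apply: (Fmax theta).
move=> a' b' /= n Fa; apply: contrapT => Fb.
by apply: n; apply: separated_base; tauto.
Qed.

(** A translation is a finite composite of basic ones, each with finitely many parameters. *)
Lemma separated_countable_params F a b : separated F setT a b ->
  exists c : nat -> A, separated F (range c) a b.
Proof.
elim=> {a b} [a b ab|o z k a b _ _ [c s]].
  by exists (fun=> a); apply: separated_base.
(* The first [arity o] terms of [c'] list [z]; the sequence [c] follows, shifted by [arity o]. *)
pose c' m := if insub m is Some i then z i else c (m - arity o)%N.
exists c'; apply: (separated_step z k).
  by move=> i; exists (val i) => //; rewrite /c' valK.
apply: separated_sub s => _ [m _ <-]; exists (arity o + m)%N => //.
by rewrite /c' insubF ?addKn// ltnNge leq_addr.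
Qed.

(** The functions [w - - n] serve as countably many binary Skolem functions: a set closed under them
    contains parameters separating any two of its points that are separated at all. *)
Lemma exists_separating_params F : exists w : A -> A -> nat -> A,
  forall a b, separated F setT a b -> separated F (range (w a b)) a b.
Proof.
have /choice[w wP] (p : A * A) : exists c : nat -> A,
    separated F setT p.1 p.2 -> separated F (range c) p.1 p.2.
  have [/separated_countable_params[c cP]|n] := EM (separated F setT p.1 p.2).
    by exists c.
  by exists (fun=> p.1).
by exists (fun a b => w (a, b)) => a b; apply: (wP (a, b)).
Qed.

End Separated.

(** * Evaluation of formulas and countability *)

Fixpoint eval (S : signature) (V : Type) (A : algebra S) (v : V -> A)
    (t : formula S V) : A :=
  match t with
  | Var x => v x
  | App o f => interp (fun i => eval S V A v (f i))
  end.
Arguments eval {S V A} v t.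

Lemma eval_hom (S : signature) (V : Type) (A : algebra S) (v : V -> A) :
  is_hom (A := Fm S V) (eval v).
Proof. by []. Qed.

(** An encoding into finite trees labelled by naturals, a type that [pickle] injects into the
    naturals. *)
Fixpoint formula_tree (S : signature) (V : Type) (f : symbol S -> nat)
    (g : V -> nat) (t : formula S V) : GenTree.tree nat :=
  match t with
  | Var x => GenTree.Leaf (g x)
  | App o h => GenTree.Node (f o)
      [seq formula_tree S V f g (h i) | i <- enum 'I_(arity o)]
  end.

Lemma formula_tree_inj (S : signature) (V : Type) (f : symbol S -> nat)
    (g : V -> nat) :
  injective f -> injective g -> injective (formula_tree S V f g).
Proof.
move=> f_inj g_inj; elim=> [x|o h IH] [y|o' h'] //=.
  by case=> /g_inj ->.
case=> /f_inj oo'; subst o' => /eq_in_map hh'; congr App; apply: funext => i.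
by apply: IH; apply: hh'; rewrite mem_enum.
Qed.

Lemma card_le_inj (T U : Type) :
  [set: T] #<= [set: U] -> exists f : T -> U, injective f.
Proof.
move=> /card_leP[f]; exists (fun x => val (f (exist _ x (in_setT x)))) => x y.
by move=> /val_inj /(@inj _ _ _ f); rewrite !in_setT => /(_ isT isT)[].
Qed.

Lemma formula_countable (S : signature) (V : Type) :
  countable [set: symbol S] -> countable [set: V] ->
  countable [set: formula S V].
Proof.
move=> /card_le_inj[f f_inj] /card_le_inj[g g_inj].
apply/countable_injP; exists (pickle \o formula_tree S V f g) => x y _ _ /=.
move=> /(pcan_inj pickleK); exact: formula_tree_inj.
Qed.

(** A left inverse of an injection of [T] into [V], with the default value [t] outside the image. *)
Lemma countable_surj (V T : Type) (t : T) : [set: V] #= [set: nat] ->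
  countable [set: T] -> exists s : V -> T, forall x, exists y, s y = x.
Proof.
rewrite card_eq_le => /andP[_ NV] /card_le_trans/(_ NV)/card_le_inj[f f_inj].
suff /choice[s sP] : forall y, exists x, forall x', f x' = y -> x = x'.
  by exists s => x; exists (f x); apply: sP.
move=> y; have [[x fx]|n] := EM (exists x, f x = y).
  by exists x => x'; rewrite -fx => /f_inj.
by exists t => x' fx'; case: n; exists x'.
Qed.

(** * Skolem hulls as homomorphic images of the formula algebra *)

Section Skolem.
Context {S : signature} {A : algebra S} {I : Type} (w : I -> A -> A -> A).

(** Each [w i] becomes a binary operation, so that closure under Skolem functions is closure under
    operations. *)
Definition skolem_signature : signature :=
  @Signature (symbol S + I)%type
    (fun o => match o with inl o => arity o | inr _ => 2 end).

Definition skolem_algebra : algebra skolem_signature :=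
  @Algebra skolem_signature A (fun o =>
    match o with
    | inl o => @interp S A o
    | inr i => fun x => w i (x ord0) (x ord_max)
    end).

End Skolem.

(** The hull of [a] and [b] consists of the values of the expanded terms in two variables. There are
    countably many such terms, so [s] maps the variables [V] onto them, and [k] sends each variable
    to the value of its term. *)
Lemma exists_skolem_closed_hom (S : signature) (V I : Type) (A : algebra S)
    (w : I -> A -> A -> A) (a b : A) :
  countable [set: symbol S] -> countable [set: I] -> [set: V] #= [set: nat] ->
  exists k : Fm S V -> A, [/\ is_hom k, range k a, range k b &
    forall i x y, range k x -> range k y -> range k (w i x y)].
Proof.
move=> hS hI hV.
pose S' := @skolem_signature S I; pose A' : algebra S' := skolem_algebra w.
pose e : formula S' bool -> A' :=
  @eval S' bool A' (fun c : bool => if c then a else b).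
have [s sP] : exists s : V -> formula S' bool, forall x, exists y, s y = x.
  apply: countable_surj => //; first exact: Var true.
  apply: formula_countable => //.
  have [f f_inj] := card_le_inj _ _ hS; have [g g_inj] := card_le_inj _ _ hI.
  apply/countable_injP; exists (fun o => pickle (match o with
    | inl o => inl (f o) | inr i => inr (g i) end : nat + nat)%type).
  by move=> [o|i] [o'|i'] _ _ /(pcan_inj pickleK)// [] => [/f_inj|/g_inj] ->.
pose k : Fm S V -> A := eval (e \o s : V -> A).
(* The range of [k] does not exceed the hull, which is closed under the operations of [A]. *)
have ke t : exists u, e u = k t.
  elim: t => [x|o f IH]; first by exists (s x).
  have [u uP] := choice IH.
  exists (@App S' bool (inl o) u) => /=.
  by congr interp; apply: funext => i; apply: uP.
have ek u : range k (e u) by have [y <-] := sP u; exists (Var S y).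
exists k; split.
- exact: eval_hom.
- exact: ek (Var S' true).
- exact: ek (Var S' false).
move=> i _ _ [t _ <-] [t' _ <-]; have [u <-] := ke t; have [u' <-] := ke t'.
exact: ek (@App S' bool (inr i) (fun j => if j == ord0 then u else u')).
Qed.

(** * Filters and Leibniz congruences under preimage *)

Section Pullback.
Context {S : signature} {V : Type} {A : algebra S} {k : Fm S V -> A}.
Context (k_hom : is_hom k).

Lemma theory_preimage (L : logic S V) (F : set A) :
  deductive_filter L A F -> theory L (k @^-1` F).
Proof.
move=> LF G phi Gphi h h_hom hG; apply: (LF G phi Gphi (k \o h)).
  by move=> o x /=; rewrite h_hom k_hom.
by move=> _ [t Gt <-]; apply: hG; exists t.
Qed.

(** Translations of formulas are pushed forward by [k]. A translation of [A] lifts to formulas once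
    its parameters lie in the range of [k], which the hypothesis provides. *)
Lemma leibniz_preimage (F : set A) :
  (forall x y, range k x -> range k y -> separated F setT x y ->
     separated F (range k) x y) ->
  forall t u, leibniz (k @^-1` F) t u <-> leibniz F (k t) (k u).
Proof.
have k_subst (o : symbol S) (f : 'I_(arity o) -> Fm S V) i t :
    k (interp (subst_at _ _ f i t)) =
    interp (subst_at _ A (fun j => k (f j)) i (k t)).
  rewrite k_hom; congr interp; apply: funext => j.
  by rewrite /subst_at; case: eqP.
move=> range_sep t u; rewrite !leibniz_separated; split=> n s; apply: n.
  have {s} : separated F (range k) (k t) (k u).
    by apply: range_sep s; [exists t|exists u].
  (* The endpoints are generalised over all their preimages, as the induction moves to translates of
     [t] and [u]. *)
  move ex: (k t) => x; move ey: (k u) => y s.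
  elim: s t u ex ey => {x y} [x y xy|o z i x y kz _ IH] t u ex ey.
    by apply: separated_base; rewrite /preimage /= ex ey.
  have /choice[f fP] j : exists v, k v = z j.
    by have [v _ <-] := kz j; exists v.
  have {fP} fz : (fun j => k (f j)) = z by apply: funext.
  apply: (separated_step f i) => //.
  by apply: IH; rewrite k_subst fz ?ex ?ey.
elim: s => {t u} [t u tu|o f i t u _ _ IH]; first exact: separated_base.
apply: (separated_step (fun j => k (f j)) i) => //.
by rewrite -!k_subst.
Qed.

End Pullback.

(** * Transfer from theories to filters of an arbitrary algebra *)

Lemma exists_hom_leibniz_preimage_eq (S : signature) (V : Type)
    (A : algebra S) (F G : set A) (a b : A) :
  countable [set: symbol S] -> [set: V] #= [set: nat] ->
  leibniz F = leibniz G ->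
  exists k : Fm S V -> A, [/\ is_hom k, range k a, range k b &
    leibniz (k @^-1` F) = leibniz (k @^-1` G)].
Proof.
move=> hS hV FG.
have [wF wFP] := exists_separating_params F.
have [wG wGP] := exists_separating_params G.
(* The Skolem functions of [F] and [G] form one family, so that a single hull serves both
   filters. *)
pose w (i : bool * nat) x y := (if i.1 then wF else wG) x y i.2.
have [k [k_hom ka kb kw]] :=
  exists_skolem_closed_hom S V _ A w a b hS (countableP _) hV.
exists k; split=> //; apply: congruence_ext => t u.
rewrite !(leibniz_preimage k_hom) ?FG// => x y kx ky.
  move=> /wGP; apply: separated_sub => _ [n _ <-].
  exact: (kw (false, n)).
move=> /wFP; apply: separated_sub => _ [n _ <-].
exact: (kw (true, n)).
Qed.

Theorem theorem5p6 (S : signature) (V : Type)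
    (hS : countable [set: symbol S]) (hV : [set: V] #= [set: nat])
    (L : logic S V) :
  (set_inj (theory L) (@leibniz S (Fm S V)) ->
     forall A : algebra S, set_inj (deductive_filter L A) (@leibniz S A)) /\
  (almost_inj (theory L) (@leibniz S (Fm S V)) ->
     forall A : algebra S, almost_inj (deductive_filter L A) (@leibniz S A)).
Proof.
split=> inj A.
  suff sub F G : deductive_filter L A F -> deductive_filter L A G ->
      leibniz F = leibniz G -> F `<=` G.
    by move=> F G /set_mem LF /set_mem LG FG; apply/seteqP; split; apply: sub.
  move=> LF LG FG a Fa.
  have [k [k_hom [t _ ta] _ kFG]] :=
    exists_hom_leibniz_preimage_eq S V A F G a a hS hV FG.
  have eqk : k @^-1` F = k @^-1` G.
    by apply: inj => //; apply: mem_set; apply: theory_preimage.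
  have : (k @^-1` G) t by rewrite -eqk /preimage /= ta.
  by rewrite /preimage /= ta.
suff sub F G : deductive_filter L A F -> deductive_filter L A G ->
    G !=set0 -> leibniz F = leibniz G -> F `<=` G.
  move=> F G /set_mem[LF F0] /set_mem[LG G0] FG.
  by apply/seteqP; split; apply: sub.
move=> LF LG [b Gb] FG a Fa.
(* The point [b] of [G] is put into the range as well, so that both preimages are non-empty. *)
have [k [k_hom [t _ ta] [u _ ub] kFG]] :=
  exists_hom_leibniz_preimage_eq S V A F G a b hS hV FG.
have eqk : k @^-1` F = k @^-1` G.
  apply: inj => //; apply: mem_set; split; try exact: theory_preimage.
    by exists t; rewrite /preimage /= ta.
  by exists u; rewrite /preimage /= ub.
have : (k @^-1` G) t by rewrite -eqk /preimage /= ta.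
by rewrite /preimage /= ta.
Qed.
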